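(* Let $f:\mathbb{R}^d\to\mathbb{R}$ be $\beta$-smooth with minimum value $f^\star$, let $\alpha>0$, $\delta\in(0,\tfrac12)$, and run $T$ steps of SGD $w_{t+1}=w_t-\eta g_t$ (arbitrary $w_1$, $g_t$ a fresh answer of a stochastic gradient oracle with bounded affine noise with parameters $\sigma_0,\sigma_1\ge0$ at $w_t$) with the fixed step size $$\eta=\min\Big\{\frac{1}{4\beta(1+\sigma_1^2\log\frac T\delta)},\ \frac{\alpha}{\sigma_0\sqrt T}\Big\}.$$ Then with probability at least $1-2\delta$: (i) $\displaystyle\frac1T\sum_{t=1}^T\|\nabla f(w_t)\|^2\le\Big(\beta\alpha+\frac{\Delta_1}\alpha\Big)\frac{2\sigma_0}{\sqrt T}+\Big(8\beta\Delta_1(1+4\sigma_1^2)\log\tfrac T\delta+24\sigma_1^2\beta^2\alpha^2\log\tfrac1\delta+15\sigma_0^2\log\tfrac1\delta\Big)\frac1T$; (ii) $f(w_t)-f^\star\le F$ for all $1\le t\le T+1$, where $\Delta_1=f(w_1)-f^\star$ and $$F=2\Delta_1+2\beta\alpha^2+3\min\Big\{\frac{\sigma_0^2}{4\beta(1+\sigma_1^2\log\frac T\delta)},\ \frac{\sigma_0\alpha}{\sqrt T}\Big\}\log\tfrac T\delta.$$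
   Context: $\|\cdot\|$ is the Euclidean norm and $\log$ the base-2 logarithm. $\beta$-smooth: $\|\nabla f(x)-\nabla f(y)\|\le\beta\|x-y\|$; $f$ attains its minimum $f^\star$. Oracle: queried at $w$, returns random $g(w)$ with $\mathbb{E}[g(w)\mid w]=\nabla f(w)$ and, with probability one, $\|g(w)-\nabla f(w)\|^2\le\sigma_0^2+\sigma_1^2\|\nabla f(w)\|^2$; in particular $\mathbb{E}[g_t\mid g_1,\dots,g_{t-1}]=\nabla f(w_t)$. *)

(* Defs.v *)
From HB Require Import structures.
From mathcomp Require Import all_boot all_order all_algebra.
From mathcomp Require Import all_classical all_reals all_analysis.
Set Implicit Arguments. Unset Strict Implicit. Unset Printing Implicit Defensive.
Import Order.TTheory GRing.Theory Num.Theory.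
Import numFieldNormedType.Exports.
Local Open Scope classical_set_scope.
Local Open Scope ring_scope.

Section Defs.
Variable R : realType.

Definition log2 (x : R) : R := ln x / ln 2.

Definition dotv {d : nat} (u v : 'rV[R]_d) : R := \sum_(i < d) u 0 i * v 0 i.
Definition sqnorm {d : nat} (v : 'rV[R]_d) : R := dotv v v.
Definition enorm {d : nat} (v : 'rV[R]_d) : R := Num.sqrt (sqnorm v).

Definition is_gradient {d : nat} (f : 'rV[R]_d -> R) (gradf : 'rV[R]_d -> 'rV[R]_d) :=
  forall x, differentiable f x /\ forall v, 'd f x v = dotv (gradf x) v.

Definition smooth {d : nat} (beta : R) (gradf : 'rV[R]_d -> 'rV[R]_d) :=
  forall x y, enorm (gradf x - gradf y) <= beta * enorm (x - y).

(* SGD iterates: sgd w1 eta g t = w_t for t >= 1, with w_1 = w1 and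
   w_{t+1} = w_t - eta g_t.  (Index 0 is unused and equals w_1.) *)
Fixpoint sgd_aux {T : Type} {d : nat} (w1 : 'rV[R]_d) (eta : R)
    (g : nat -> T -> 'rV[R]_d) (n : nat) (x : T) : 'rV[R]_d :=
  match n with
  | 0 => w1
  | n'.+1 => sgd_aux w1 eta g n' x - eta *: g n'.+1 x
  end.
Definition sgd {T : Type} {d : nat} (w1 : 'rV[R]_d) (eta : R)
    (g : nat -> T -> 'rV[R]_d) (t : nat) (x : T) : 'rV[R]_d :=
  sgd_aux w1 eta g t.-1 x.

(* Fixed step size eta = min{ 1/(4 beta (1 + s1^2 log(T/delta))), alpha/(s0 sqrt T) },
   where the second term is +oo (hence ignored) when s0 = 0. *)
Definition step_size (beta alpha delta s0 s1 : R) (T : nat) : R :=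
  let a := (4 * beta * (1 + s1 ^+ 2 * log2 (T%:R / delta)))^-1 in
  if s0 == 0 then a else Num.min a (alpha / (s0 * Num.sqrt T%:R)).

Definition filtration {d0} {Om : measurableType d0} (F : nat -> set (set Om)) :=
  forall t, [/\ sigma_algebra setT (F t), F t `<=` measurable &
                F t `<=` F t.+1].

Definition measurable_wrt {d0} {Om : measurableType d0} (G : set (set Om))
    (X : Om -> R) :=
  forall B : set R, measurable B -> G (X @^-1` B).

End Defs.

(* Main.v *)
Require Import Defs.
From HB Require Import structures.
From mathcomp Require Import all_boot all_order all_algebra.
From mathcomp Require Import all_classical all_reals all_analysis.
From mathcomp Require Import measurable_realfun.
From mathcomp Require Import ring lra.
Import Order.TTheory GRing.Theory Num.Theory.
Import numFieldNormedType.Exports.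
Local Open Scope classical_set_scope.
Local Open Scope ring_scope.
Set Implicit Arguments. Unset Strict Implicit. Unset Printing Implicit Defensive.

(* Idea.  Write [W_n] for the iterates, [xi_n] for the noise, [G_n] for the squared
   gradient norm, [Y_n] for the suboptimality gap and [Z_n] for [- <grad, xi_n>].
   Smoothness and [4 beta eta (1 + s1^2) <= 1] give
     [Y_(n+1) <= Y_n - 7/8 eta G_n + beta eta^2 s0^2 / 2 + c Z_n],
     [c = eta (1 - beta eta)].
   As long as [Y_n <= Fb] one has [G_n <= 2 beta Fb], hence [Z_n^2 <= V G_n] with
   [V = s0^2 + 2 beta s1^2 Fb].  By Hoeffding's lemma, the exponential of
   [3 / (4 eta V)] times the sum of the increments [c Z_n - 3/8 eta G_n], stopped
   when [Y] first exceeds [Fb], is a supermartingale, and Markov's inequality bounds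
   this stopped sum by [4/3 eta V ln (1/delta)] with probability [1 - delta].
   The constants are such that on this event [Y] can never exceed [Fb]; hence
   nothing was stopped, and the remaining drift [eta/2 G_n] bounds the average of
   the [G_n]. *)

(** * Scalar inequalities behind Hoeffding's lemma *)

Lemma le_of_derive_ge0 (R : realType) (f df : R -> R) (a b : R) :
  a <= b -> (forall x : R, is_derive x 1 f (df x)) ->
  (forall x, a < x -> x < b -> 0 <= df x) -> f a <= f b.
Proof.
move=> ab fdf df0.
have fder x : derivable f x 1 by case: (fdf x).
apply: (@ger0_derive1_le_cc R f a b) => //.
- move=> x; rewrite in_itv/= => /andP[ax xb].
  by rewrite derive1E (@derive_val _ _ _ _ _ _ _ (fdf x)) df0.
- apply: continuous_subspaceT => x.
  by apply: differentiable_continuous; apply/derivable1_diffP.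
- by rewrite in_itv/= lexx ab.
- by rewrite in_itv/= lexx ab.
Qed.

(** The difference of the two sides vanishes at 0 and has derivative [x * (expR x - expR (- x))],
    which is nonnegative for [x >= 0]. *)
Lemma sinh_le_mul_cosh (R : realType) (u : R) : 0 <= u ->
  expR u - expR (- u) <= u * (expR u + expR (- u)).
Proof.
move=> u0.
pose h (x : R) := x * (expR x + expR (- x)) - (expR x - expR (- x)).
have : h 0 <= h u.
  apply: (@le_of_derive_ge0 R h (fun x => x * (expR x - expR (- x)))) => //.
    move=> x; rewrite /h; apply: is_derive_eq; rewrite /GRing.scale/=; ring.
  move=> x x0 _; apply: mulr_ge0; first exact: ltW.
  by rewrite subr_ge0 ler_expR; lra.
by rewrite /h oppr0 mul0r subrr subrr subr_ge0.
Qed.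

(** The product of [expR x + expR (- x)] and [expR (- (x ^+ 2 / 2))] is nonincreasing on [x >= 0]:
    by [sinh_le_mul_cosh] its negative has a nonnegative derivative. *)
Lemma cosh_le_expR_sqr (R : realType) (u : R) : 0 <= u ->
  expR u + expR (- u) <= 2 * expR (u ^+ 2 / 2).
Proof.
move=> u0.
pose h (x : R) := - ((expR x + expR (- x)) * expR (- (x ^+ 2 / 2))).
have : h 0 <= h u.
  apply: (@le_of_derive_ge0 R h (fun x =>
    (x * (expR x + expR (- x)) - (expR x - expR (- x))) * expR (- (x ^+ 2 / 2)))) => //.
    move=> x; rewrite /h; apply: is_derive_eq; rewrite /GRing.scale/=; by field.
  move=> x x0 _; apply: mulr_ge0; last exact: expR_ge0.
  by rewrite subr_ge0; apply: sinh_le_mul_cosh; exact: ltW.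
rewrite /h expr0n/= mul0r oppr0 expR0 lerN2 mulr1.
by rewrite [expR (- (_ / _))]expRN ler_pdivrMr ?expR_gt0.
Qed.

(** Convexity on [[-u, u]], multiplied by [2 * u] so that [u = 0] is covered. The tangent at [x] is
    evaluated at both endpoints; with the weights [u + x] and [u - x] the linear terms cancel. *)
Lemma expR_le_chord (R : realType) (x u : R) : `|x| <= u ->
  2 * u * expR x <= (u + x) * expR u + (u - x) * expR (- u).
Proof.
rewrite ler_norml => /andP[ux xu].
have tangent y : expR x * (1 + (y - x)) <= expR y.
  rewrite -[in leRHS](subrKC x y) expRD ler_pM2l ?expR_gt0//.
  exact: expR_ge1Dx.
have h1 : (u + x) * (expR x * (1 + (u - x))) <= (u + x) * expR u.
  by apply: ler_wpM2l; [lra | exact: tangent].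
have h2 : (u - x) * (expR x * (1 + (- u - x))) <= (u - x) * expR (- u).
  by apply: ler_wpM2l; [lra | exact: tangent].
apply: le_trans (lerD h1 h2); rewrite le_eqVlt; apply/orP; left; apply/eqP; ring.
Qed.

(* Equals [exp (- u^2 / 2) * sinh u / u] for [u > 0], and [0] at [u = 0]. *)
Definition hoeffding_slope (R : realType) (u : R) : R :=
  expR (- (u ^+ 2 / 2)) * (expR u - expR (- u)) / 2 * (u `^ (-1)).

(** For [u > 0] the upper bound is sinh u <= u cosh u <= u exp(u^2 / 2). It keeps the coefficients
    of the noise bounded, hence their products with the noise integrable. *)
Lemma hoeffding_slope_bound (R : realType) (u : R) : 0 <= u ->
  0 <= hoeffding_slope u <= 1.
Proof.
rewrite /hoeffding_slope => u0; rewrite powR_inv1//.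
have [->|un0] := eqVneq u 0; first by rewrite invr0 mulr0 lexx ler01.
have up : 0 < u by rewrite lt_def un0.
have s0 : 0 <= expR u - expR (- u) by rewrite subr_ge0 ler_expR; lra.
rewrite -!mulrA mulr_ge0 ?expR_ge0// ?mulr_ge0 ?invr_ge0//=.
rewrite expRN mulrC ler_pdivrMr ?expR_gt0// mul1r mulrA ler_pdivrMr//.
have := sinh_le_mul_cosh u0; have := cosh_le_expR_sqr u0.
rewrite [u * (u / 2)]mulrA -expr2; set e := expR _ => h1 h2; have h3 := ler_wpM2l u0 h1.
lra.
Qed.

(** Hoeffding's lemma before taking expectations: the right side is affine in [x], so it averages to
    1 against centered noise even when [u] is random, provided [u] depends on the past only. The
    chord bounds the exponential, and cosh u <= exp(u^2 / 2) bounds its constant term. *)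
Lemma hoeffding_pointwise (R : realType) (x u : R) : `|x| <= u ->
  expR (x - u ^+ 2 / 2) <= 1 + x * hoeffding_slope u.
Proof.
move=> xu; have u0 : 0 <= u := le_trans (normr_ge0 _) xu.
rewrite /hoeffding_slope powR_inv1//.
have [u00|un0] := eqVneq u 0.
  move: xu; rewrite u00 normr_le0 => /eqP ->.
  by rewrite expr0n/= mul0r subr0 expR0 mul0r addr0.
have up : 0 < u by rewrite lt_def un0.
rewrite -(ler_pM2r (expR_gt0 (u ^+ 2 / 2))) -expRD subrK.
have chord := expR_le_chord xu; have ch := cosh_le_expR_sqr u0.
set e := expR (u ^+ 2 / 2) in ch *.
have -> : (1 + x * (expR (- (u ^+ 2 / 2)) * (expR u - expR (- u)) / 2 / u)) * e
   = e + x * ((expR u - expR (- u)) / 2 / u).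
  rewrite expRN -/e; field; rewrite un0/= gt_eqF//; exact: expR_gt0.
rewrite -(ler_pM2l (_ : 0 < 2 * u)); last by rewrite mulr_gt0.
apply: le_trans chord _.
have -> : 2 * u * (e + x * ((expR u - expR (- u)) / 2 / u)) =
  u * (2 * e) + x * (expR u - expR (- u)) by field.
have := ler_wpM2l u0 ch; lra.
Qed.

(** From exp(1/8) >= 9/8 and (9/8)^6 >= 2. It turns the factor 4/3 in front of a natural logarithm
    into a base-2 logarithm. *)
Lemma ln2_le (R : realType) : ln (2 : R) <= 3 / 4.
Proof.
rewrite -ler_expR lnK ?posrE//.
have -> : (3 / 4 : R) = 8^-1 * 6%:R by field.
rewrite expRM_natr.
have h : (9 / 8 : R) <= expR 8^-1 by have := expR_ge1Dx (8^-1 : R); lra.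
apply: (@le_trans _ _ ((9 / 8) ^+ 6)); first by rewrite !exprS expr0; lra.
by apply: lerXn2r => //; rewrite nnegrE; [lra | exact: expR_ge0].
Qed.

(** * Euclidean geometry and smooth functions *)

Section Vectors.
Variables (R : realType) (d : nat).
Implicit Types (u v x y : 'rV[R]_d).

Lemma dotvC u v : dotv u v = dotv v u.
Proof. by apply: eq_bigr => i _; rewrite mulrC. Qed.

Lemma dotvDl u v x : dotv (u + v) x = dotv u x + dotv v x.
Proof. by rewrite -big_split; apply: eq_bigr => i _; rewrite mxE mulrDl. Qed.

Lemma dotvZl (a : R) u v : dotv (a *: u) v = a * dotv u v.
Proof. by rewrite mulr_sumr; apply: eq_bigr => i _; rewrite mxE mulrA. Qed.

Lemma dotvNl u v : dotv (- u) v = - dotv u v.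
Proof. by rewrite -scaleN1r dotvZl mulN1r. Qed.

Lemma dotvDr x u v : dotv x (u + v) = dotv x u + dotv x v.
Proof. by rewrite dotvC dotvDl ![dotv _ x]dotvC. Qed.

Lemma dotvZr (a : R) u v : dotv u (a *: v) = a * dotv u v.
Proof. by rewrite dotvC dotvZl dotvC. Qed.

Lemma sqnorm_ge0 u : 0 <= sqnorm u.
Proof. by apply: sumr_ge0 => i _; rewrite -expr2 sqr_ge0. Qed.

Lemma sqr_coord_le_sqnorm u i : u 0 i ^+ 2 <= sqnorm u.
Proof.
rewrite /sqnorm /dotv (bigD1 i)//= -expr2 lerDl.
by apply: sumr_ge0 => j _; rewrite -expr2 sqr_ge0.
Qed.

Lemma sqnormD u v : sqnorm (u + v) = sqnorm u + 2 * dotv u v + sqnorm v.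
Proof. rewrite /sqnorm dotvDl !dotvDr [dotv v u]dotvC; ring. Qed.

Lemma sqnormZ (a : R) u : sqnorm (a *: u) = a ^+ 2 * sqnorm u.
Proof. by rewrite /sqnorm dotvZl dotvZr mulrA -expr2. Qed.

(** The squared norm of |v|^2 u - <u,v> v equals |v|^2 (|u|^2 |v|^2 - <u,v>^2); divide by |v|^2 when
    it is nonzero. *)
Lemma cauchy_schwarz_dotv u v : dotv u v ^+ 2 <= sqnorm u * sqnorm v.
Proof.
have [v0|vn0] := eqVneq (sqnorm v) 0.
  suff -> : dotv u v = 0 by rewrite expr0n v0 mulr0.
  apply: big1 => i _; have := sqr_coord_le_sqnorm v i.
  rewrite v0 => vi; have /eqP : v 0 i ^+ 2 == 0 by rewrite eq_le vi sqr_ge0.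
  by move/eqP; rewrite sqrf_eq0 => /eqP ->; rewrite mulr0.
have vp : 0 < sqnorm v by rewrite lt_def vn0 sqnorm_ge0.
have := sqnorm_ge0 (sqnorm v *: u + (- dotv u v) *: v).
rewrite sqnormD !sqnormZ dotvZl dotvZr => h.
rewrite -subr_ge0 -(pmulr_rge0 _ vp); apply: le_trans h _.
by rewrite le_eqVlt; apply/orP; left; apply/eqP; ring.
Qed.

Lemma dotv_le_enorm u v : dotv u v <= enorm u * enorm v.
Proof.
rewrite (le_trans (ler_norm _))// /enorm -sqrtrM ?sqnorm_ge0//.
by rewrite -sqrtr_sqr ler_wsqrtr// cauchy_schwarz_dotv.
Qed.

Lemma enorm_sqr u : enorm u ^+ 2 = sqnorm u.
Proof. by rewrite /enorm sqr_sqrtr ?sqnorm_ge0. Qed.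

Lemma enormZ (a : R) u : 0 <= a -> enorm (a *: u) = a * enorm u.
Proof. by move=> a0; rewrite /enorm sqnormZ sqrtrM ?sqr_ge0// sqrtr_sqr ger0_norm. Qed.

Lemma coord_le_enorm u i : `|u 0 i| <= enorm u.
Proof. by rewrite -sqrtr_sqr ler_wsqrtr// sqr_coord_le_sqnorm. Qed.

Lemma enorm_le_coord u (r : R) : 0 <= r -> (forall i, `|u 0 i| <= r) ->
  enorm u <= d.+1%:R * r.
Proof.
move=> r0 ur; have dr0 : 0 <= d.+1%:R * r by rewrite mulr_ge0.
rewrite -(ger0_norm dr0) -sqrtr_sqr ler_wsqrtr// exprMn.
apply: (@le_trans _ _ (\sum_(i < d) r ^+ 2)).
  by apply: ler_sum => i _; rewrite -expr2 -real_normK ?num_real// ler_sqr ?nnegrE.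
rewrite sumr_const card_ord -[leLHS]mulr_natl ler_wpM2r ?sqr_ge0//.
by rewrite -natrX ler_nat (leq_trans (leqnSn d))// leq_pmull.
Qed.

Lemma is_derive_line (f : 'rV[R]_d -> R) (gradf : 'rV[R]_d -> 'rV[R]_d) x v (t : R) :
  is_gradient f gradf ->
  is_derive t 1 (fun s : R => f (x + s *: v)) (dotv (gradf (x + t *: v)) v).
Proof.
move=> fg; have [fd fdE] := fg (x + t *: v).
have E : (fun h : R => h^-1 *: (((fun s => f (x + s *: v)) \o shift t) (h *: (1 : R))
            - f (x + t *: v))) =
         (fun h : R => h^-1 *: ((f \o shift (x + t *: v)) (h *: v) - f (x + t *: v))).
  apply/funext => h /=; congr (_ *: (f _ - _)).
  by rewrite [h *: 1]mulr1 scalerDl addrCA.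
have dv := @diff_derivable _ _ _ f (x + t *: v) v fd.
apply: DeriveDef.
  by rewrite /derivable E.
by rewrite /derive E -fdE -deriveE.
Qed.

(** Along the segment, the quadratic model minus [f] has derivative beta t |v|^2 - <grad f(x + t v)
    - grad f(x), v>, nonnegative by Cauchy-Schwarz and the Lipschitz bound. Monotonicity replaces
    the usual integral of the gradient. *)
Lemma descent (f : 'rV[R]_d -> R) (gradf : 'rV[R]_d -> 'rV[R]_d) (beta : R) x v :
  is_gradient f gradf -> smooth beta gradf ->
  f (x + v) <= f x + dotv (gradf x) v + beta / 2 * sqnorm v.
Proof.
move=> fg sm.
pose h (t : R) := t * dotv (gradf x) v + beta / 2 * sqnorm v * t ^+ 2 - f (x + t *: v).
have : h 0 <= h 1.
  apply: (@le_of_derive_ge0 _ h (fun t => dotv (gradf x) v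
      + beta * sqnorm v * t - dotv (gradf (x + t *: v)) v)) => //.
    move=> t; have Hl := is_derive_line x v t fg.
    rewrite /h; apply: is_derive_eq; rewrite /GRing.scale/=; by field.
  move=> t t0 _.
  have h2 := dotv_le_enorm (gradf (x + t *: v) - gradf x) v.
  have h1 := sm (x + t *: v) x.
  have xE : x + t *: v - x = t *: v by rewrite addrC addKr.
  rewrite xE (enormZ v (ltW t0)) in h1; rewrite dotvDl dotvNl in h2.
  have v0 : 0 <= enorm v by exact: sqrtr_ge0.
  have h3 := ler_wpM2r v0 h1; rewrite -enorm_sqr expr2; lra.
rewrite /h scale0r addr0 expr0n/= scale1r expr1n; lra.
Qed.

(** A gradient step of length 1 / beta lowers [f] by at least |grad f(x)|^2 / (2 beta), yet cannot
    go below [fstar]. *)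
Lemma sqnorm_grad_le (f : 'rV[R]_d -> R) (gradf : 'rV[R]_d -> 'rV[R]_d)
    (beta fstar : R) x :
  is_gradient f gradf -> 0 < beta -> smooth beta gradf ->
  (forall w, fstar <= f w) -> sqnorm (gradf x) <= 2 * beta * (f x - fstar).
Proof.
move=> fg b0 sm fs.
have := descent x (- beta^-1 *: gradf x) fg sm.
rewrite dotvZr sqnormZ -/(sqnorm _) => h; have h1 := le_trans (fs _) h.
have h2 : beta / 2 * ((- beta^-1) ^+ 2 * sqnorm (gradf x)) =
  2^-1 * beta^-1 * sqnorm (gradf x) by field; rewrite gt_eqF.
rewrite h2 in h1.
have : 0 <= f x - fstar - 2^-1 * beta^-1 * sqnorm (gradf x) by lra.
rewrite -(pmulr_rge0 _ (_ : 0 < 2 * beta)) ?mulr_gt0// => h3.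
rewrite -subr_ge0; apply: le_trans h3 _.
rewrite le_eqVlt; apply/orP; left; apply/eqP; field; by rewrite gt_eqF.
Qed.

Lemma smooth_continuous (gradf : 'rV[R]_d -> 'rV[R]_d) (beta : R) i :
  0 < beta -> smooth beta gradf -> continuous (fun x => gradf x 0 i).
Proof.
move=> b0 sm x; apply/(@cvgrPdist_lt _ _ _ (nbhs x) (nbhs_filter x)) => e e0.
(* Balls of row vectors are coordinatewise, and passing to the Euclidean norm costs a factor [d.+1];
   dividing by [d.+2] makes the final inequality strict. *)
have e1 : 0 < e / beta / d.+2%:R by rewrite !divr_gt0.
near=> y.
have h1 : `|gradf x 0 i - gradf y 0 i| <= beta * enorm (x - y).
  by apply: le_trans (sm x y); have := coord_le_enorm (gradf x - gradf y) i; rewrite !mxE.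
apply: le_lt_trans h1 _.
rewrite mulrC -ltr_pdivlMr//.
apply: (@le_lt_trans _ _ (d.+1%:R * (e / beta / d.+2%:R))).
  apply: enorm_le_coord; first exact: ltW.
  have [_ xy] : ball x (e / beta / d.+2%:R) y.
    near: y; apply: nbhsx_ballx; exact: e1.
  by move=> j; rewrite !mxE; apply: ltW; exact: xy.
by rewrite mulrCA gtr_pMr ?divr_gt0// ltr_pdivrMr// mul1r ltr_nat.
Unshelve. all: by end_near.
Qed.
End Vectors.

(** * Measurability with respect to a sub-sigma-algebra *)

Section SubSigmaAlgebra.
Variables (R : realType) (d0 : measure_display) (Om : measurableType d0).
Implicit Types (G : set (set Om)) (X : Om -> R).

(** This transfers the closure properties of measurable functions to a sub-sigma-algebra, by viewing
    it as the sigma-algebra of another measurable type. *)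
Lemma measurable_wrtP G X : sigma_algebra setT G ->
  measurable_wrt G X <-> measurable_fun (setT : set (g_sigma_algebraType G)) X.
Proof.
move=> sG; split=> mX.
  move=> _ B mB; rewrite setTI /measurable/= sigma_algebra_id//.
  exact: mX.
move=> B mB; have := mX measurableT B mB.
by rewrite setTI /measurable/= sigma_algebra_id.
Qed.

Lemma measurable_wrt_measurable G X : G `<=` measurable ->
  measurable_wrt G X -> measurable_fun setT X.
Proof. by move=> Gm mX _ B mB; rewrite setTI; apply: Gm; exact: mX. Qed.

Lemma measurable_wrtW G G' X : G `<=` G' -> measurable_wrt G X -> measurable_wrt G' X.
Proof. by move=> GG mX B mB; apply: GG; exact: mX. Qed.
End SubSigmaAlgebra.

(** * Continuous functions of measurable row vectors *)

Section ContinuousRow.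
Variables (R : realType) (d : nat).

Definition quantize (n : nat) (x : 'rV[R]_d) : 'rV[R]_d :=
  \row_i ((Num.floor (x 0 i * n.+1%:R))%:~R / n.+1%:R).

Lemma quantize_cvg (x : 'rV[R]_d) : quantize ^~ x @ \oo --> x.
Proof.
apply/cvg_ballP => e e0; near=> n; split=> // j i; rewrite !ord1 mxE /ball/=.
have n0 : 0 < n.+1%:R :> R by [].
have /andP[h1 h2] := floor_itv (x 0 i * n.+1%:R).
rewrite ger0_norm; last by rewrite subr_ge0 ler_pdivrMr.
rewrite ltrBlDr -ltrBlDl ltr_pdivlMr// mulrBl ltrBlDr (lt_le_trans h2)//.
rewrite intrD lerD2l mulrC.
have : n.+1%:R^-1 < e by near: n; exact: near_infty_natSinv_lt (PosNum e0).
by rewrite invf_plt ?posrE// => h; rewrite -ler_pdivrMr// mul1r ltW.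
Unshelve. all: by end_near.
Qed.

(* The quantized map takes countably many values, so its composite with [h] is
   measurable; then let the mesh tend to [0]. *)
Lemma measurable_continuous_row (d0 : measure_display) (T : measurableType d0)
    (X : T -> 'rV[R]_d) (h : 'rV[R]_d -> R) :
  continuous h -> (forall i, measurable_fun setT (fun x => X x 0 i)) ->
  measurable_fun setT (fun x => h (X x)).
Proof.
move=> hc mX.
apply: (@measurable_fun_cvg _ _ _ setT (fun n x => h (quantize n (X x)))); last first.
  by move=> x _; apply: (cvg_comp _ _ (@quantize_cvg (X x)) (hc (X x))).
move=> n _ B mB; rewrite setTI.
pose C (k : 'rV[int]_d) : set T := [set x |
  (forall i, Num.floor (X x 0 i * n.+1%:R) = k 0 i) /\ B (h (quantize n (X x)))].
rewrite (_ : _ @^-1` B = \bigcup_k C k); last first.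
  apply/seteqP; split=> [x Bx|x [k _ []]//].
  by exists (\row_i Num.floor (X x 0 i * n.+1%:R)) => //; split=> // i; rewrite mxE.
apply: countable_bigcupT_measurable; first exact: countableP.
move=> k; pose y : 'rV[R]_d := \row_i ((k 0 i)%:~R / n.+1%:R).
have [By|NBy] := pselect (B (h y)); last first.
  rewrite (_ : C k = set0)//; apply/seteqP; split=> // x [xk Bx]; apply: NBy.
  rewrite (_ : y = quantize n (X x))//; apply/rowP => i; by rewrite !mxE xk.
rewrite (_ : C k = \bigcap_(i in [set: 'I_d])
   ((fun x => X x 0 i * n.+1%:R) @^-1` `[(k 0 i)%:~R, (k 0 i + 1)%:~R[)).
  apply: fin_bigcap_measurable => // i _.
  rewrite -[X in measurable X]setTI.
  by apply: measurable_funM => //; exact: measurable_itv.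
apply/seteqP; split=> x.
  move=> [xk _] i _ /=; rewrite in_itv/=; rewrite -floor_eq; exact/eqP.
move=> xk; have xk' i : Num.floor (X x 0 i * n.+1%:R) = k 0 i.
  apply/eqP; rewrite floor_eq; have := xk i I; by rewrite /= in_itv.
split=> //; rewrite (_ : quantize n (X x) = y)//.
by apply/rowP => i; rewrite !mxE xk'.
Qed.
End ContinuousRow.

(** * Centered noise and exponential supermartingales *)

(** The sum counts the thresholds 1, ..., N that [y] reaches, so it is the integer part of [y]. *)
Lemma sum_threshold_approx (R : realType) (y : R) (N : nat) : 0 <= y -> y <= N%:R ->
  `|y - \sum_(k < N) (k.+1%:R <= y)%R%:R| <= 1.
Proof.
move=> y0 yN.
(* The induction cannot keep [y <= N%:R], hence the alternative that all [N] thresholds are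
   reached. *)
have [h1 h2] : \sum_(k < N) (k.+1%:R <= y)%R%:R <= y /\
  (y <= \sum_(k < N) (k.+1%:R <= y)%R%:R + 1 \/
   \sum_(k < N) (k.+1%:R <= y)%R%:R = N%:R :> R).
  elim: N {yN} => [|N [IH1 IH2]]; first by rewrite big_ord0; split => //; right.
  rewrite big_ord_recr/=; set S := \sum_(k < N) _ in IH1 IH2 *.
  have [hy|hy] := leP N.+1%:R y; last first.
    rewrite addr0; split=> //; left; case: IH2 => // ->.
    by rewrite -natr1 in hy; exact: ltW.
  have SN : S <= N%:R.
    rewrite /S (le_trans (_ : _ <= \sum_(k < N) 1))//; last by rewrite sumr_const card_ord.
    by apply: ler_sum => k _; rewrite lern1 leq_b1.
  rewrite -natr1 in hy *.
  case: IH2 => [h|->]; last by split=> //; right.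
  have SE : S = N%:R by apply/eqP; rewrite eq_le SN; lra.
  by rewrite SE; split=> //; right.
rewrite ger0_norm ?subr_ge0//; case: h2 => [|->]; lra.
Qed.

Section MeanZero.
Variables (R : realType) (d0 : measure_display) (Om : measurableType d0).
Variables (P : probability Om R) (G : set (set Om)) (xi : Om -> R).
Hypotheses (sG : sigma_algebra setT G) (Gm : G `<=` measurable).
Hypothesis ixi : P.-integrable setT (EFin \o xi).
Hypothesis xi0 : forall A, G A -> (\int[P]_(x in A) (xi x)%:E = 0)%E.

Lemma integrable_mul_bounded (B : Om -> R) (M : R) :
  measurable_fun setT B -> (forall x, `|B x| <= M) ->
  P.-integrable setT (EFin \o (fun x => xi x * B x)).
Proof.
move=> mB BM; have bB : [bounded B x | x in [set: Om]].
  exists M; split; first exact: num_real.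
  by move=> y My x _; rewrite /= (le_trans (BM x))// ltW.
have := @integrableMl _ _ _ P setT measurableT _ _ ixi mB bB.
by apply: eq_integrable => // x _ /=; rewrite EFinM.
Qed.

Lemma Rintegral_mul_indic (A : set Om) : G A -> \int[P]_x (xi x * \1_A x) = 0.
Proof.
move=> GA; have := xi0 GA; rewrite integral_mkcond => h.
rewrite /Rintegral (_ : (fun x => (xi x * \1_A x)%:E) = ((fun x => (xi x)%:E) \_ A)).
  by rewrite h.
apply/funext => x; rewrite patchE indicE; case: ifP => _; by rewrite ?mulr1 ?mulr0.
Qed.

Lemma Rintegral_mul_sum_indic (A : nat -> set Om) (N : nat) : (forall k, G (A k)) ->
  \int[P]_x (xi x * \sum_(k < N) \1_(A k) x) = 0.
Proof.
move=> GA; elim: N => [|N IH].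
  under eq_Rintegral do rewrite big_ord0 mulr0.
  by rewrite Rintegral_cst// mul0r.
under eq_Rintegral do rewrite big_ord_recr/= mulrDr.
have i1 n : P.-integrable setT (EFin \o (fun x => xi x * \sum_(k < n) \1_(A k) x)).
  apply: (@integrable_mul_bounded _ n%:R).
    by apply: measurable_sum => k; apply: measurable_indic; exact: Gm.
  move=> x; rewrite ger0_norm ?sumr_ge0// (le_trans (_ : _ <= \sum_(k < n) 1))//; last first.
    by rewrite sumr_const card_ord.
  by apply: ler_sum => k _; rewrite indicE lern1 leq_b1.
have i2 : P.-integrable setT (EFin \o (fun x => xi x * \1_(A N) x)).
  apply: (@integrable_mul_bounded _ 1); first by apply: measurable_indic; exact: Gm.
  by move=> x; rewrite indicE ger0_norm// lern1 leq_b1.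
by rewrite (RintegralD measurableT (i1 N) i2) IH Rintegral_mul_indic// addr0.
Qed.

(* [B + M] is within [1/(n+1)] of an average of indicators of its superlevel sets,
   each of which integrates to [0] against [xi]. *)
Lemma Rintegral_mul_bounded_eq0 (B : Om -> R) (M : R) :
  measurable_wrt G B -> (forall x, `|B x| <= M) -> \int[P]_x (xi x * B x) = 0.
Proof.
move=> mB BM; have mB' := measurable_wrt_measurable Gm mB.
have M0 : 0 <= M by exact: le_trans (normr_ge0 _) (BM point).
have GT : G setT by case: sG => s0 sC _; have := sC _ s0; rewrite setD0.
have xiT : \int[P]_x xi x = 0 by rewrite /Rintegral xi0.
set I := \int[P]_x (xi x * B x).
(* After multiplication by [n.+1] the approximation error is at most 1, so the right side does not
   depend on [n]; the Archimedean property then forces [I = 0]. *)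
have bound (n : nat) : `|I| * n.+1%:R <= \int[P]_x `|xi x|.
  pose N := (Num.truncn (2 * M * n.+1%:R : R)).+1.
  pose A k := [set x | k.+1%:R <= (B x + M) * n.+1%:R :> R].
  have GA k : G (A k).
    rewrite (_ : A k = B @^-1` `[k.+1%:R / n.+1%:R - M, +oo[); first exact: mB.
    by apply/seteqP; split=> x; rewrite /A/= in_itv/= andbT lerBlDr ler_pdivrMr.
  pose e x := (B x + M) * n.+1%:R - \sum_(k < N) \1_(A k) x.
  have e1 x : `|e x| <= 1.
    rewrite /e (eq_bigr (fun k : 'I_N =>
      (k.+1%:R <= (B x + M) * n.+1%:R)%R%:R)); last first.
      by move=> k _; rewrite indicE; congr (nat_of_bool _)%:R; apply/idP/idP; rewrite inE.
    have := BM x; rewrite ler_norml => /andP[b1 b2].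
    apply: sum_threshold_approx; first by rewrite mulr_ge0//; lra.
    apply: (@le_trans _ _ (2 * M * n.+1%:R)); first by rewrite ler_wpM2r//; lra.
    by rewrite ltW// /N truncnS_gt.
  have mS : measurable_fun setT (fun x => \sum_(k < N) \1_(A k) x : R).
    by apply: measurable_sum => k; apply: measurable_indic; exact: Gm.
  have me : measurable_fun setT e.
    by apply: measurable_funB => //; apply: measurable_funM => //; exact: measurable_funD.
  have ie := integrable_mul_bounded me e1.
  have iS : P.-integrable setT (EFin \o (fun x => xi x * \sum_(k < N) \1_(A k) x)).
    apply: (@integrable_mul_bounded _ N%:R) => // x.
    rewrite ger0_norm ?sumr_ge0// (le_trans (_ : _ <= \sum_(k < N) 1))//; last first.
      by rewrite sumr_const card_ord.
    by apply: ler_sum => k _; rewrite indicE lern1 leq_b1.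
  have iB := integrable_mul_bounded mB' BM.
  have IE : I * n.+1%:R = \int[P]_x (xi x * e x).
    have h : \int[P]_x (xi x * e x + xi x * \sum_(k < N) \1_(A k) x) =
             \int[P]_x (n.+1%:R * (xi x * B x) + M * n.+1%:R * xi x).
      by apply: eq_Rintegral => x _; rewrite /e; ring.
    move: h; rewrite !RintegralD//=; last 2 first.
    - by have := integrableZl measurableT n.+1%:R iB.
    - by have := integrableZl measurableT (M * n.+1%:R) ixi.
    rewrite !RintegralZl// xiT Rintegral_mul_sum_indic// -/I mulr0 !addr0 => ->.
    by rewrite mulrC.
  rewrite -[n.+1%:R]ger0_norm// -normrM IE.
  apply: le_trans (le_normr_Rintegral _ ie) _ => //.
  apply: le_Rintegral => //.
  - exact: (integrable_abse ie).
  - exact: (integrable_abse ixi).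
  by move=> x _; rewrite normrM ler_piMr.
apply/eqP; rewrite -normr_eq0 eq_le normr_ge0 andbT leNgt; apply/negP => I0.
have := bound (Num.truncn (\int[P]_x `|xi x| / `|I|)).
apply/negP; rewrite -ltNge mulrC -ltr_pdivrMr//.
exact: truncnS_gt.
Qed.

(** Replacing [B] by 0 where it exceeds the bound keeps it [G]-measurable, makes it bounded
    everywhere and changes it on a null set only. The threshold is the absolute value of [M], so the
    default 0 always respects it. *)
Lemma Rintegral_mul_ae_bounded_eq0 (B : Om -> R) (M : R) :
  measurable_wrt G B -> {ae P, forall x, `|B x| <= M} ->
  P.-integrable setT (EFin \o (fun x => xi x * B x)) /\ \int[P]_x (xi x * B x) = 0.
Proof.
move=> mB BM; have mB' := measurable_wrt_measurable Gm mB.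
pose B' x := if `|B x| <= `|M| then B x else 0.
have B'M x : `|B' x| <= `|M| by rewrite /B'; case: ifP => // _; rewrite normr0.
have mB'G : measurable_wrt G B'.
  apply/(measurable_wrtP _ sG); apply: measurable_fun_ifT => //.
    apply: measurable_fun_ler => //; apply: measurableT_comp => //.
    exact/(measurable_wrtP _ sG).
  exact/(measurable_wrtP _ sG).
have mB'm := measurable_wrt_measurable Gm mB'G.
have i' := integrable_mul_bounded mB'm B'M.
have mxi : measurable_fun setT xi by exact/measurable_EFinP/(measurable_int P).
have mm : measurable_fun setT (EFin \o (fun x => xi x * B x)).
  by apply/measurable_EFinP; exact: measurable_funM.
have aeE : ae_eq P setT (EFin \o (fun x => xi x * B x)) (EFin \o (fun x => xi x * B' x)).
  apply: filterS BM => x Bx _ /=; congr (_ * _)%:E.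
  by rewrite /B' (le_trans Bx (ler_norm M)).
split.
  apply/integrableP; split=> //; case/integrableP: (i') => mi; apply: le_lt_trans.
  rewrite le_eqVlt; apply/orP; left; apply/eqP.
  apply: ae_eq_integral => //; [exact: measurableT_comp|exact: measurableT_comp|].
  by apply: filterS aeE => x h _; exact: (congr1 abse (h I)).
rewrite -(Rintegral_mul_bounded_eq0 mB'G B'M) /Rintegral; congr fine.
by apply: ae_eq_integral => //; case/integrableP: i'.
Qed.
End MeanZero.

Section Supermartingale.
Variables (R : realType) (d0 : measure_display) (Om : measurableType d0).
Variables (P : probability Om R) (G : set (set Om)).
Hypotheses (sG : sigma_algebra setT G) (Gm : G `<=` measurable).

Lemma centered_noise (g h : Om -> R) :
  P.-integrable setT (EFin \o g) -> measurable_wrt G h ->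
  (forall A, G A -> (\int[P]_(x in A) (g x)%:E = \int[P]_(x in A) (h x)%:E)%E) ->
  P.-integrable setT (EFin \o (fun x => g x - h x)) /\
  forall A, G A -> (\int[P]_(x in A) (g x - h x)%:E = 0)%E.
Proof.
move=> ig mh gh.
have GT : G setT by case: sG => s0 sC _; have := sC _ s0; rewrite setD0.
have mh' := measurable_wrt_measurable Gm mh.
have ih : P.-integrable setT (EFin \o h).
  apply/integrableP; split; first exact/measurable_EFinP.
  (* Integrability of [h] comes from the case [A = setT]: its integral equals that of [g], hence is
     finite, and infinity minus infinity counts as infinite. *)
  apply/abse_integralP => //; first exact/measurable_EFinP.
  have := gh _ GT; rewrite /comp => <-.
  by rewrite -ge0_fin_numE// abse_fin_num; exact: integrable_fin_num.
split.
  by have := integrableB measurableT ig ih; apply: eq_integrable.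
move=> A GA; have mA := Gm GA.
have igA := integrableS measurableT mA (@subsetT _ _) ig.
have ihA := integrableS measurableT mA (@subsetT _ _) ih.
rewrite (integralB_EFin mA igA ihA) gh// subee//.
exact: integrable_fin_num.
Qed.

Lemma ae_bounded_integrable (X : Om -> R) (K : R) : measurable_fun setT X ->
  {ae P, forall x, `|X x| <= K} -> P.-integrable setT (EFin \o X).
Proof.
move=> mX XK; apply/integrableP; split; first exact/measurable_EFinP.
apply: (@le_lt_trans _ _ (\int[P]_x (`|K|%:E))%E).
  apply: ae_ge0_le_integral => //.
  - by apply: measurableT_comp => //; exact/measurable_EFinP.
  - by apply: filterS XK => x XK _; rewrite /= lee_fin (le_trans XK)// ler_norm.
by rewrite integral_cst//= probability_setT mule1 ltry.
Qed.

(** Multiplying the bound on [D] by [M] gives M + sum_i xi_i B_i M, where each B_i M is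
    [G]-measurable and almost surely bounded, so each noise term integrates to 0. Conditional
    expectations are thus avoided. *)
Lemma supermartingale_step (d : nat) (xi B : 'I_d -> Om -> R) (M D : Om -> R) (K C : R) :
  (forall i, P.-integrable setT (EFin \o xi i)) ->
  (forall i A, G A -> (\int[P]_(x in A) (xi i x)%:E = 0)%E) ->
  (forall i, measurable_wrt G (B i)) -> (forall i, {ae P, forall x, `|B i x| <= C}) ->
  measurable_wrt G M -> (forall x, 0 <= M x) -> {ae P, forall x, M x <= K} ->
  measurable_fun setT D -> (forall x, 0 <= D x) ->
  {ae P, forall x, D x <= 1 + \sum_(i < d) xi i x * B i x} ->
  (\int[P]_x (M x * D x)%:E <= \int[P]_x (M x)%:E)%E.
Proof.
move=> ixi xi0 mB BC mM M0 MK mD D0 Dle.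
have mM' := measurable_wrt_measurable Gm mM.
have BM i : P.-integrable setT (EFin \o (fun x => xi i x * (B i x * M x))) /\
    \int[P]_x (xi i x * (B i x * M x)) = 0.
  apply: (Rintegral_mul_ae_bounded_eq0 sG Gm (ixi i) (xi0 i) (M := C * K)).
    apply/(measurable_wrtP _ sG); apply: measurable_funM; exact/(measurable_wrtP _ sG).
  apply: filterS2 (BC i) MK => x Bx Mx; rewrite normrM ler_pM// ger0_norm//.
have iM : P.-integrable setT (EFin \o M).
  by apply: (@ae_bounded_integrable _ K) => //; apply: filterS MK => x; rewrite ger0_norm.
pose S x := (\sum_(i < d) (xi i x * (B i x * M x))%:E)%E.
have iS : P.-integrable setT S.
  by apply: integrable_sum => // i _; case: (BM i).
have S0 : (\int[P]_x S x = 0)%E.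
  rewrite integral_sum//; last by move=> i; case: (BM i).
  apply: big1 => i _; have [i1 i2] := BM i.
  by rewrite -[LHS]fineK ?(integrable_fin_num measurableT i1)//; congr EFin.
pose r x := ((M x)%:E + S x)%E.
have ir : P.-integrable setT r by exact: integrableD.
have -> : (\int[P]_x (M x)%:E = \int[P]_x r x)%E.
  by rewrite /r integralD// S0 adde0.
have rle : {ae P, forall x, ((M x * D x)%:E <= r x)%E}.
  apply: filterS Dle => x Dx; rewrite /r /S sumEFin -EFinD lee_fin.
  have := ler_wpM2l (M0 x) Dx; rewrite mulrDr mulr1 mulr_sumr.
  by under eq_bigr do rewrite mulrCA [M x * _]mulrC.
(* Almost surely [r] dominates the nonnegative [M * D], so it may be replaced by its absolute value,
   and monotonicity for nonnegative functions applies. *)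
have -> : (\int[P]_x r x = \int[P]_x `|r x|)%E.
  apply: ae_eq_integral => //.
  - exact: (measurable_int P).
  - by apply: measurableT_comp => //; exact: (measurable_int P).
  apply: filterS rle => x rx _; rewrite gee0_abs//; apply: le_trans rx.
  by rewrite lee_fin mulr_ge0.
apply: ae_ge0_le_integral => //.
- by move=> x _; rewrite lee_fin mulr_ge0.
- by apply/measurable_EFinP; exact: measurable_funM.
- by apply: measurableT_comp => //; exact: (measurable_int P).
- by apply: filterS rle => x rx _; apply: le_trans rx _; exact: lee_abs.
Qed.

Lemma markov_expR (Q : Om -> R) (delta : R) : 0 < delta -> measurable_fun setT Q ->
  (\int[P]_x (expR (Q x))%:E <= 1)%E ->
  ((1 - delta)%:E <= P [set x | (Q x <= ln delta^-1)%R])%E.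
Proof.
move=> d0' mQ I1.
set E := [set x | _].
have mE : measurable E.
  rewrite /E -[X in measurable X]setTI.
  rewrite (_ : [set x | _] = Q @^-1` `]-oo, ln delta^-1]); first exact: mQ.
  by apply/seteqP; split=> x; rewrite /= in_itv.
have mexp : measurable_fun setT (EFin \o (fun x => expR (Q x))).
  by apply/measurable_EFinP; apply: measurableT_comp => //; exact: measurable_expR.
have di : 0 < delta^-1 by rewrite invr_gt0.
have lnE y : (ln delta^-1 <= y) = (delta^-1 <= expR y) by rewrite -ler_expR lnK ?posrE.
have := @le_integral_abse _ _ _ P setT measurableT _ _ mexp di.
rewrite setTI => h.
have {}h : (delta^-1%:E * P (~` E) <= 1)%E.
  apply: le_trans (le_trans h _); last first.
    apply: le_trans I1; rewrite le_eqVlt; apply/orP; left; apply/eqP.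
    by apply: eq_integral => x _; rewrite /= ger0_norm ?expR_ge0.
  apply: lee_wpmul2l; first by rewrite lee_fin ltW.
  apply: le_measure; rewrite ?inE; [exact: measurableC| |].
    rewrite (_ : [set x | _] = Q @^-1` `[ln delta^-1, +oo[).
      by rewrite -[X in measurable X]setTI; exact: mQ.
    apply/seteqP; split=> x /=; rewrite in_itv/= andbT lee_fin ger0_norm ?expR_ge0//;
      by rewrite lnE.
  move=> x /=; rewrite /E/= => /negP; rewrite -ltNge => /ltW Qx.
  by rewrite lee_fin ger0_norm ?expR_ge0// -lnE.
have PE : P E = (1 - P (~` E))%E by rewrite -probability_setC ?setCK//; exact: measurableC.
have PC : P (~` E) \is a fin_num by rewrite fin_num_measure//; exact: measurableC.
rewrite PE -(fineK PC) -EFinB lee_fin lerB//.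
move: h; rewrite -(fineK PC) -EFinM lee_fin mulrC ler_pdivrMr// mul1r; exact.
Qed.
End Supermartingale.

(** * The stopped descent inequality and the step size *)

(** The indicator that the first exit time exceeds [n]. It depends only on the past up to [n], so it
    multiplies the [n]-th increment as a predictable factor. *)
Definition alive (R : realType) (Y : nat -> R) (Fb : R) (n : nat) : R :=
  \prod_(j < n.+1) (if Y j <= Fb then 1 else 0).

Lemma alive_bound (R : realType) (Y : nat -> R) (Fb : R) (n : nat) :
  (forall j, (j <= n)%N -> Y j <= Fb) /\ alive Y Fb n = 1 \/
  (exists2 j, (j <= n)%N & Fb < Y j) /\ alive Y Fb n = 0.
Proof.
have [h|h] := pselect (forall j, (j <= n)%N -> Y j <= Fb).
  by left; split=> //; apply: big1 => j _; rewrite h// -ltnS ltn_ord.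
right; move/existsNP: h => [j /not_implyP[jn /negP]]; rewrite -ltNge => jY.
split; first by exists j.
have jn' : (j < n.+1)%N by [].
by rewrite /alive (bigD1 (Ordinal jn'))//= leNgt jY mul0r.
Qed.

(* At the first exit time [n] of [Y] from [(-oo, Fb]] the increments [q k] with
   [k >= n] are switched off, so that the bound on the stopped sum applies to
   the whole sum up to [n]. *)
Lemma stopped_descent (R : realType) (Y G q : nat -> R) (T : nat) (Fb h e kappa : R) :
  0 <= h -> 0 <= e -> (forall n, 0 <= Y n) -> (forall n, 0 <= G n) ->
  (forall n, (n < T)%N -> Y n.+1 <= Y n - h * G n + e + q n) ->
  \sum_(k < T) alive Y Fb k * q k <= kappa ->
  Y 0%N + T%:R * e + kappa <= Fb ->
  (forall n, (n <= T)%N -> Y n <= Fb) /\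
  h * \sum_(k < T) G k <= Y 0%N + T%:R * e + kappa.
Proof.
move=> h0 e0 Y0 G0 step Nk YFb.
have tele n : (n <= T)%N ->
    Y n + h * \sum_(k < n) G k <= Y 0%N + n%:R * e + \sum_(k < n) q k.
  elim: n => [_|n IH nT]; first by rewrite !big_ord0 mulr0 mul0r !addr0.
  rewrite !big_ord_recr/= -natr1 mulrDr mulrDl mul1r.
  have := IH (ltnW nT); have := step n nT; lra.
have hG n : 0 <= h * \sum_(k < n) G k by rewrite mulr_ge0// sumr_ge0.
have allY n : (n <= T)%N -> Y n <= Fb.
  elim/ltn_ind: n => n IH nT; rewrite leNgt; apply/negP => Yn.
  have NE : \sum_(k < T) alive Y Fb k * q k = \sum_(k < n) q k.
    rewrite (big_ord_widen _ q nT) [RHS]big_mkcond/=; apply: eq_bigr => k _.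
    case: ifP => [kn|/negbT]; last rewrite -leqNgt => nk.
      have [[_ ->]|[[j jk Yj] _]] := alive_bound Y Fb k; first by rewrite mul1r.
      have jn : (j < n)%N := leq_ltn_trans jk kn.
      by have := IH j jn (ltnW (leq_trans jn nT)); rewrite leNgt Yj.
    have [[hY _]|[_ ->]] := alive_bound Y Fb k; last by rewrite mul0r.
    by have := hY n nk; rewrite leNgt Yn.
  have nTe : n%:R * e <= T%:R * e by rewrite ler_wpM2r// ler_nat.
  have := tele n nT; have := hG n; rewrite NE in Nk; lra.
split=> //.
have NE : \sum_(k < T) alive Y Fb k * q k = \sum_(k < T) q k.
  apply: eq_bigr => k _.
  have [[_ ->]|[[j jk Yj] _]] := alive_bound Y Fb k; first by rewrite mul1r.
  by have := allY j (leq_trans jk (ltnW (ltn_ord k))); rewrite leNgt Yj.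
have := tele T (leqnn T); have := Y0 T; rewrite NE in Nk; lra.
Qed.

Section StepSize.
Variables (R : realType) (beta alpha delta s0 s1 : R) (T : nat).
Hypotheses (b0 : 0 < beta) (a0 : 0 < alpha) (dl0 : 0 < delta) (dl2 : delta < 2^-1).
Hypotheses (s00 : 0 <= s0) (s10 : 0 <= s1) (T0 : (0 < T)%N).
Let eta : R := step_size beta alpha delta s0 s1 T.
Let LT : R := log2 (T%:R / delta).
Let L1 : R := log2 (delta^-1).
Let m : R := Num.min (s0 ^+ 2 / (4 * beta * (1 + s1 ^+ 2 * LT)))
                 (s0 * alpha / Num.sqrt T%:R).

Lemma ln2_gt0 : 0 < ln (2 : R).
Proof. by rewrite ln_gt0// ltr1n. Qed.

Lemma log_ge1 : 1 <= L1.
Proof.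
rewrite /L1 /log2 ler_pdivlMr ?ln2_gt0// mul1r ler_ln ?posrE ?invr_gt0//.
by rewrite ltW// -(invrK 2) ltf_pV2 ?posrE.
Qed.

Lemma log_le : L1 <= LT.
Proof.
rewrite /L1 /LT /log2 ler_pM2r ?invr_gt0 ?ln2_gt0//.
rewrite ler_ln ?posrE ?divr_gt0 ?invr_gt0 ?ltr0n//.
by rewrite ler_peMl ?ler1n// invr_ge0 ltW.
Qed.

Lemma ln_le_log : 0 <= ln delta^-1 <= 3 / 4 * L1.
Proof.
have -> : ln delta^-1 = ln 2 * L1.
  by rewrite /L1 /log2 mulrC divfK// gt_eqF// ln2_gt0.
have L0 : 0 <= L1 by apply: le_trans log_ge1.
by rewrite mulr_ge0 ?(ltW ln2_gt0)//= ler_wpM2r// ln2_le.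
Qed.

Let D : R := 4 * beta * (1 + s1 ^+ 2 * LT).
Let r : R := Num.sqrt (T%:R : R).

Lemma sqrtT_gt0 : 0 < r.
Proof. by rewrite sqrtr_gt0 ltr0n. Qed.

Lemma stepD_gt0 : 0 < D.
Proof.
rewrite /D !mulr_gt0// ltr_pwDl// mulr_ge0 ?sqr_ge0//.
by have := log_ge1; have := log_le; lra.
Qed.

Lemma step_size_gt0 : 0 < eta.
Proof.
rewrite /eta /step_size -/LT -/D; case: eqP => [_|/eqP sn0].
  by rewrite invr_gt0 stepD_gt0.
rewrite lt_min invr_gt0 stepD_gt0 divr_gt0// mulr_gt0 ?sqrtT_gt0//.
by rewrite lt_def sn0.
Qed.

Lemma step_size_le : eta * D <= 1.
Proof.
rewrite -ler_pdivlMr ?stepD_gt0// mul1r /eta /step_size -/LT -/D.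
by case: eqP => // _; rewrite ge_min lexx.
Qed.

(** This identifies the minimum in the level [Fb]; for [s0 = 0] both sides vanish, whichever branch
    defines the step. *)
Lemma step_size_noise : eta * s0 ^+ 2 = m.
Proof.
rewrite /eta /step_size -/LT -/D /m -/LT -/D; case: eqP => [->|/eqP sn0].
  by rewrite expr0n mulr0 !mul0r minxx.
rewrite mulrC minr_pMr ?sqr_ge0//; congr Num.min.
by rewrite -/r; field; rewrite sn0 gt_eqF ?sqrtT_gt0.
Qed.

Lemma step_size_sqrt : eta * s0 * r <= alpha.
Proof.
rewrite /eta /step_size -/LT -/D -/r; case: eqP => [->|/eqP sn0].
  by rewrite mulr0 mul0r ltW.
have sp : 0 < s0 by rewrite lt_def sn0.
rewrite -mulrA -ler_pdivlMr ?mulr_gt0 ?sqrtT_gt0//.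
by rewrite ge_min lexx orbT.
Qed.

(** The inverse of a minimum is the maximum of the inverses, hence at most their sum. *)
Lemma step_size_inv : eta^-1 <= D + s0 * r / alpha.
Proof.
have Dp := stepD_gt0; have rp := sqrtT_gt0.
rewrite /eta /step_size -/LT -/D -/r; case: eqP => [->|/eqP sn0].
  by rewrite invrK !mul0r addr0.
have sp : 0 < s0 by rewrite lt_def sn0.
have h : 0 <= s0 * r / alpha by rewrite divr_ge0 ?mulr_ge0// ltW.
case: (leP D^-1 (alpha / (s0 * r))) => _.
  by rewrite invrK lerDl.
by rewrite invf_div lerDr ltW.
Qed.

(** * Choice of the level: drift and noise fit into the budget *)

Section Budget.
Variables (Delta1 : R).
Hypothesis D10 : 0 <= Delta1.
Let Fb : R := 2 * Delta1 + 2 * beta * alpha ^+ 2 + 3 * m * LT.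
Let V : R := s0 ^+ 2 + 2 * beta * s1 ^+ 2 * Fb.
Let e : R := beta * eta ^+ 2 * s0 ^+ 2 / 2.
Let kappa : R := 4 / 3 * eta * V * ln delta^-1.

Lemma noise_level_ge0 : 0 <= m.
Proof. by rewrite -step_size_noise mulr_ge0 ?sqr_ge0// ltW// step_size_gt0. Qed.

Lemma log_horizon_ge1 : 1 <= LT.
Proof. exact: le_trans log_ge1 log_le. Qed.

Lemma level_gt0 : 0 < Fb.
Proof.
have h1 : 0 < beta * alpha ^+ 2 by rewrite mulr_gt0// exprn_gt0.
have h2 : 0 <= m * LT by rewrite mulr_ge0 ?noise_level_ge0// (le_trans _ log_horizon_ge1).
have -> : Fb = 2 * Delta1 + 2 * (beta * alpha ^+ 2) + 3 * (m * LT) by rewrite /Fb; ring.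
move: h2 h1 D10; move: (m * LT) (beta * alpha ^+ 2) Delta1 => x y z; lra.
Qed.

Lemma variance_ge0 : 0 <= V.
Proof.
by rewrite addr_ge0 ?sqr_ge0// !mulr_ge0 ?sqr_ge0 ?(ltW b0)// (ltW level_gt0).
Qed.

Lemma step_var_le : beta * eta * s1 ^+ 2 * LT <= 4^-1.
Proof.
have h : 0 < beta * eta by rewrite mulr_gt0// step_size_gt0.
have := step_size_le.
have -> : eta * D = 4 * (beta * eta) + 4 * (beta * eta * s1 ^+ 2 * LT) by rewrite /D; ring.
by move: h; set x := beta * eta * s1 ^+ 2 * LT; lra.
Qed.

Lemma budget_drift : T%:R * e <= beta * alpha ^+ 2 / 2.
Proof.
have -> : T%:R * e = beta * (eta * s0 * r) ^+ 2 / 2.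
  by rewrite /e exprMn sqr_sqrtr ?ler0n//; ring.
rewrite ler_pM2r ?invr_gt0// ler_pM2l// ler_sqr ?nnegrE ?step_size_sqrt//.
  by rewrite !mulr_ge0 ?(ltW step_size_gt0) ?(ltW sqrtT_gt0).
exact: ltW.
Qed.

(** The level occurs on both sides, because [V] contains [Fb]. By [step_var_le] that part of [kappa]
    is at most Fb / 2, and the rest, at most Delta1 + beta alpha^2 / 2 + m LT, fits into the other
    half. *)
Lemma budget_le : Delta1 + T%:R * e + kappa <= Fb.
Proof.
have /andP[l0 l1] := ln_le_log; have L1T := log_le.
(* Since ln 2 <= 3/4, 4/3 ln(1/delta) is at most [L1], hence at most [LT]. *)
have h : kappa <= eta * V * LT.
  have -> : kappa = eta * V * (4 / 3 * ln delta^-1) by rewrite /kappa; ring.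
  by rewrite ler_wpM2l ?mulr_ge0 ?variance_ge0 ?(ltW step_size_gt0)//; lra.
have h2 : eta * V * LT <= m * LT + Fb / 2.
  have -> : eta * V * LT = m * LT + 2 * Fb * (beta * eta * s1 ^+ 2 * LT).
    by rewrite -step_size_noise /V; ring.
  rewrite lerD2l; have := step_var_le; have := level_gt0; set a := _ * LT => F0 ha.
  have := ler_wpM2l (ltW F0) ha; lra.
have := budget_drift.
have h3 : 0 < beta * alpha ^+ 2 by rewrite mulr_gt0// exprn_gt0.
have h4 : 0 <= m * LT by rewrite mulr_ge0 ?noise_level_ge0// (le_trans _ log_horizon_ge1).
have FE : Fb = 2 * Delta1 + 2 * (beta * alpha ^+ 2) + 3 * (m * LT) by rewrite /Fb; ring.
lra.
Qed.

Lemma average_le (S : R) :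
  eta / 2 * S <= Delta1 + T%:R * e + kappa ->
  T%:R^-1 * S <= (beta * alpha + Delta1 / alpha) * (2 * s0 / Num.sqrt T%:R)
           + (8 * beta * Delta1 * (1 + 4 * s1 ^+ 2) * LT
              + 24 * s1 ^+ 2 * beta ^+ 2 * alpha ^+ 2 * L1
              + 15 * s0 ^+ 2 * L1) * T%:R^-1.
Proof.
have ep := step_size_gt0; have rp := sqrtT_gt0; rewrite -/r => hS.
have TE : T%:R = r ^+ 2 by rewrite sqr_sqrtr.
(* The hypothesis divided by [eta / 2], with [T] written as [r ^+ 2]. *)
have S1 : S <= 2 * Delta1 * eta^-1 + beta * (eta * s0 * r) * (s0 * r)
              + 8 / 3 * V * ln delta^-1.
  rewrite -(ler_pM2l (_ : 0 < eta / 2)) ?divr_gt0//; apply: le_trans hS _.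
  rewrite le_eqVlt; apply/orP; left; apply/eqP; rewrite /e /kappa TE.
  by field; rewrite gt_eqF.
have /andP[l0 l1] := ln_le_log; have L1T := log_le; have L11 := log_ge1.
have h1 : Delta1 * eta^-1 <= Delta1 * (D + s0 * r / alpha).
  by rewrite ler_wpM2l// step_size_inv.
have h2 : beta * (eta * s0 * r) * (s0 * r) <= beta * alpha * (s0 * r).
  by rewrite ler_wpM2r ?mulr_ge0 ?(ltW rp)// ler_pM2l// step_size_sqrt.
have h3 : 8 / 3 * V * ln delta^-1 <= V * (2 * L1).
  have := ler_wpM2l variance_ge0 l1; lra.
(* The term [3 * m * LT] of [Fb] would give a product of two logarithms; with [m = eta * s0 ^+ 2]
   one of them is absorbed in beta eta s1^2 LT <= 1/4. *)
have VE : V * (2 * L1) = 2 * (s0 ^+ 2 * L1) + 8 * (beta * Delta1 * s1 ^+ 2 * L1)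
   + 8 * (beta ^+ 2 * s1 ^+ 2 * alpha ^+ 2 * L1)
   + 12 * (s0 ^+ 2 * L1 * (beta * eta * s1 ^+ 2 * LT)).
  by rewrite /V /Fb -step_size_noise; ring.
have h4 : s0 ^+ 2 * L1 * (beta * eta * s1 ^+ 2 * LT) <= s0 ^+ 2 * L1 * 4^-1.
  by rewrite ler_wpM2l ?step_var_le// mulr_ge0 ?sqr_ge0//; lra.
have bD : 0 <= beta * Delta1 by rewrite mulr_ge0// ltW.
have h5 : beta * Delta1 <= beta * Delta1 * LT by rewrite ler_peMr// log_horizon_ge1.
have bDs : 0 <= beta * Delta1 * s1 ^+ 2 by rewrite mulr_ge0 ?sqr_ge0.
have h6 : beta * Delta1 * s1 ^+ 2 * L1 <= beta * Delta1 * s1 ^+ 2 * LT.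
  by rewrite ler_wpM2l.
have h60 : 0 <= beta * Delta1 * s1 ^+ 2 * L1 by rewrite mulr_ge0//; lra.
have h7 : 0 <= beta ^+ 2 * s1 ^+ 2 * alpha ^+ 2 * L1.
  by rewrite mulr_ge0 ?(le_trans ler01 L11)// -!exprMn sqr_ge0.
have h8 : 0 <= s0 ^+ 2 * L1 by rewrite mulr_ge0 ?sqr_ge0//; lra.
have h9 : 0 <= beta * alpha * (s0 * r) by rewrite !mulr_ge0// ltW.
have S2 : S <= 2 * (beta * alpha + Delta1 / alpha) * (s0 * r)
   + (8 * beta * Delta1 * (1 + 4 * s1 ^+ 2) * LT
              + 24 * s1 ^+ 2 * beta ^+ 2 * alpha ^+ 2 * L1
              + 15 * s0 ^+ 2 * L1).
  have DE : Delta1 * (D + s0 * r / alpha) = 4 * (beta * Delta1)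
     + 4 * (beta * Delta1 * s1 ^+ 2 * LT) + Delta1 / alpha * (s0 * r).
    by rewrite /D; ring.
  have -> : 2 * (beta * alpha + Delta1 / alpha) * (s0 * r)
     + (8 * beta * Delta1 * (1 + 4 * s1 ^+ 2) * LT
              + 24 * s1 ^+ 2 * beta ^+ 2 * alpha ^+ 2 * L1
              + 15 * s0 ^+ 2 * L1) =
     2 * (beta * alpha * (s0 * r)) + 2 * (Delta1 / alpha * (s0 * r))
     + 8 * (beta * Delta1 * LT) + 32 * (beta * Delta1 * s1 ^+ 2 * LT)
     + 24 * (beta ^+ 2 * s1 ^+ 2 * alpha ^+ 2 * L1) + 15 * (s0 ^+ 2 * L1) by ring.
  rewrite VE in h3; rewrite DE in h1; rewrite -mulrA in S1.
  apply: le_trans S1 _; clear -h1 h2 h3 h4 h5 h6 h60 h7 h8 h9.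
  lra.
rewrite -(ler_pM2l (_ : 0 < (T%:R : R))) ?ltr0n// mulVKf ?pnatr_eq0 -?lt0n//.
apply: le_trans S2 _; rewrite le_eqVlt; apply/orP; left; apply/eqP.
rewrite TE; field; rewrite !gt_eqF//.
Qed.
End Budget.
End StepSize.

(** * The stopped SGD process *)

Section SGD.
Variables (R : realType) (d : nat) (f : 'rV[R]_d -> R) (gradf : 'rV[R]_d -> 'rV[R]_d).
Variables (beta fstar eta s0 s1 Fb : R) (T : nat).
Variables (d0 : measure_display) (Om : measurableType d0) (P : probability Om R).
Variables (F : nat -> set (set Om)) (g : nat -> Om -> 'rV[R]_d) (w1 : 'rV[R]_d).
Hypotheses (fg : is_gradient f gradf) (b0 : 0 < beta) (sm : smooth beta gradf).
Hypotheses (fs : forall w, fstar <= f w) (eta0 : 0 < eta).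
Hypotheses (etale : 4 * beta * eta * (1 + s1 ^+ 2) <= 1) (Fb0 : 0 < Fb).
Hypothesis filtF : filtration F.

(** Indices are shifted by one: [W n] is the iterate w_(n+1). It is known at time [n] and is updated
    with the answer [g n.+1]. *)
Let W := sgd_aux w1 eta g.
Let Y n x := f (W n x) - fstar.
Let Gr n x := sqnorm (gradf (W n x)).
Let xi n x := g n.+1 x - gradf (W n x).
Let Z n x := - dotv (gradf (W n x)) (xi n x).
(** The two terms linear in the noise, from the first-order term and from the cross term of the
    squared step, combine to this coefficient. *)
Let c := eta * (1 - beta * eta).
Let V := s0 ^+ 2 + 2 * beta * s1 ^+ 2 * Fb.
Let e := beta * eta ^+ 2 * s0 ^+ 2 / 2.
(** Of the drift 7/8 eta Gr, the share 3/8 is put here to pay for the quadratic term of Hoeffding's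
    bound; the remaining 1/2 serves the conclusion. *)
Let q n x := c * Z n x - 3 / 8 * eta * Gr n x.
Let a n x := alive (Y ^~ x) Fb n.
Let N n x := \sum_(k < n) a k x * q k x.
Let noise n x := sqnorm (xi n x) <= s0 ^+ 2 + s1 ^+ 2 * Gr n x.

Lemma coef_bounds : 0 < c <= eta.
Proof.
have be : 0 < beta * eta by rewrite mulr_gt0.
have bs : 0 <= beta * eta * s1 ^+ 2 by rewrite mulr_ge0 ?sqr_ge0// ltW.
have h : 4 * beta * eta * (1 + s1 ^+ 2) = 4 * (beta * eta) + 4 * (beta * eta * s1 ^+ 2).
  by ring.
have := etale; rewrite h => h2; rewrite /c mulr_gt0//=; last by lra.
by rewrite ger_pMr//; lra.
Qed.

Lemma variance_proxy_ge0 : 0 <= V.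
Proof.
rewrite addr_ge0 ?sqr_ge0// mulr_ge0 ?(ltW Fb0)// mulr_ge0 ?sqr_ge0//.
by rewrite mulr_ge0// ltW.
Qed.

Lemma gap_ge0 n x : 0 <= Y n x. Proof. by rewrite subr_ge0. Qed.

Lemma sqnorm_grad_ge0 n x : 0 <= Gr n x. Proof. exact: sqnorm_ge0. Qed.

Lemma sqnorm_grad_le_gap n x : Gr n x <= 2 * beta * Y n x.
Proof. exact: sqnorm_grad_le. Qed.

(** The descent lemma with g = grad + xi and the noise bound leave -eta + beta eta^2 (1 + s1^2) / 2
    in front of [Gr n x], which [etale] bounds by -7/8 eta. *)
Lemma sgd_descent n x : noise n x ->
  Y n.+1 x <= Y n x - eta / 2 * Gr n x + e + q n x.
Proof.
rewrite /noise => nx.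
have := descent (W n x) (- eta *: g n.+1 x) fg sm.
have gE : g n.+1 x = gradf (W n x) + xi n x by rewrite /xi addrC subrK.
rewrite sqnormZ dotvZr {2 3}gE dotvDr sqnormD -/(sqnorm (gradf (W n x))) -/(Gr n x).
have -> : dotv (gradf (W n x)) (xi n x) = - Z n x by rewrite /Z opprK.
have -> : W n x + - eta *: g n.+1 x = W n.+1 x by rewrite scaleNr.
have k0 : 0 <= beta / 2 * eta ^+ 2 by rewrite mulr_ge0 ?sqr_ge0// divr_ge0// ltW.
have := ler_wpM2l k0 nx.
have k1 : 0 <= eta * Gr n x by rewrite mulr_ge0 ?sqnorm_grad_ge0// ltW.
have := ler_wpM2l k1 etale.
rewrite /Y /q /c /e.
move: (f (W n.+1 x)) (f (W n x)) (Gr n x) (Z n x) (sqnorm (xi n x)).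
move=> y1 y G z s h1 h2 h3.
lra.
Qed.

(** The bound is kept proportional to the gradient norm, so that its square can be compensated by
    the drift. *)
Lemma noise_dot_bound n x : noise n x -> Y n x <= Fb ->
  `|Z n x| <= Num.sqrt V * enorm (gradf (W n x)).
Proof.
rewrite /noise => nx YF.
have V0 := variance_proxy_ge0.
rewrite -sqrtr_sqr /enorm -sqrtrM// ler_wsqrtr// /Z sqrrN.
apply: le_trans (cauchy_schwarz_dotv _ _) _; rewrite mulrC ler_wpM2r ?sqnorm_ge0//.
apply: le_trans nx _; rewrite /V lerD2l.
have := ler_wpM2l (sqr_ge0 s1) (le_trans (sqnorm_grad_le_gap n x) (ler_wpM2l _ YF)).
have -> : s1 ^+ 2 * (2 * beta * Fb) = 2 * beta * s1 ^+ 2 * Fb by ring.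
by apply; rewrite mulr_ge0// ltW.
Qed.

Lemma grad_bound n x : Y n x <= Fb -> enorm (gradf (W n x)) <= Num.sqrt (2 * beta * Fb).
Proof.
move=> YF; rewrite ler_wsqrtr//; apply: le_trans (sqnorm_grad_le_gap n x) _.
by rewrite ler_wpM2l// mulr_ge0// ltW.
Qed.

(** * Adaptedness of the stopped process *)

Hypothesis mg : forall n i, (n < T)%N -> measurable_wrt (F n.+1) (fun x => g n.+1 x 0 i).

Lemma iterate_measurable n i : (n <= T)%N -> measurable_wrt (F n) (fun x => W n x 0 i).
Proof.
elim: n i => [|n IH] i nT.
  have [sF _ _] := filtF 0%N.
  by apply/(measurable_wrtP _ sF) => /=; exact: measurable_cst.
have [_ _ Fs] := filtF n; have [sF' _ _] := filtF n.+1.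
apply/(measurable_wrtP _ sF').
rewrite (_ : (fun x => _) = fun x => W n x 0 i - eta * g n.+1 x 0 i); last first.
  by apply/funext => x /=; rewrite !mxE.
apply: measurable_funB.
  apply/(measurable_wrtP _ sF'); apply: measurable_wrtW Fs _; apply: IH; exact: ltnW.
by apply: measurable_funM => //; apply/(measurable_wrtP _ sF'); exact: mg.
Qed.

Lemma grad_measurable n i : (n <= T)%N ->
  measurable_wrt (F n) (fun x => gradf (W n x) 0 i).
Proof.
move=> nT; have [sF _ _] := filtF n; apply/(measurable_wrtP _ sF).
apply: (measurable_continuous_row (smooth_continuous b0 sm)) => j.
by apply/(measurable_wrtP _ sF); exact: iterate_measurable.
Qed.

Lemma filtration_le m n : (m <= n)%N -> F m `<=` F n.
Proof.
elim: n => [|n IH]; first by rewrite leqn0 => /eqP ->.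
rewrite leq_eqVlt => /orP[/eqP -> //|]; rewrite ltnS => /IH h.
by apply: subset_trans h _; have [] := filtF n.
Qed.

Lemma gap_measurable n : (n <= T)%N -> measurable_wrt (F n) (Y n).
Proof.
move=> nT; have [sF _ _] := filtF n; apply/(measurable_wrtP _ sF).
apply: measurable_funB => //; apply: measurable_continuous_row.
  by move=> y; apply: differentiable_continuous; case: (fg y).
by move=> j; apply/(measurable_wrtP _ sF); exact: iterate_measurable.
Qed.

Lemma alive_measurable n : (n <= T)%N -> measurable_wrt (F n) (a n).
Proof.
move=> nT; have [sF _ _] := filtF n; apply/(measurable_wrtP _ sF).
apply: measurable_prod => j _; apply: measurable_fun_ifT => //.
apply: measurable_fun_ler => //; apply/(measurable_wrtP _ sF).
have jn : (j <= n)%N by rewrite -ltnS ltn_ord.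
by apply: measurable_wrtW (filtration_le jn) _; apply: gap_measurable; exact: leq_trans nT.
Qed.

Lemma sqnorm_grad_measurable n : (n <= T)%N -> measurable_wrt (F n) (Gr n).
Proof.
move=> nT; have [sF _ _] := filtF n; apply/(measurable_wrtP _ sF).
apply: measurable_sum => i.
by apply: measurable_funM; apply/(measurable_wrtP _ sF); exact: grad_measurable.
Qed.

Lemma increment_measurable n : (n < T)%N -> measurable_wrt (F n.+1) (q n).
Proof.
move=> nT; have [sF' _ _] := filtF n.+1; have [_ _ Fs] := filtF n.
apply/(measurable_wrtP _ sF').
have mgr i : measurable_fun (setT : set (g_sigma_algebraType (F n.+1)))
    (fun x => gradf (W n x) 0 i).
  by apply/(measurable_wrtP _ sF'); apply: measurable_wrtW Fs _; exact/grad_measurable/ltnW.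
apply: measurable_funB.
  apply: measurable_funM => //; apply: measurableT_comp => //.
  apply: measurable_sum => i; apply: measurable_funM => //.
  rewrite (_ : (fun x => _) = fun x => g n.+1 x 0 i - gradf (W n x) 0 i); last first.
    by apply/funext => x; rewrite !mxE.
  by apply: measurable_funB => //; apply/(measurable_wrtP _ sF'); exact: mg.
apply: measurable_funM => //; apply/(measurable_wrtP _ sF').
by apply: measurable_wrtW Fs _; exact/sqnorm_grad_measurable/ltnW.
Qed.

Lemma stopped_sum_measurable n : (n <= T)%N -> measurable_wrt (F n) (N n).
Proof.
move=> nT; have [sF _ _] := filtF n; apply/(measurable_wrtP _ sF).
apply: measurable_sum => k.
have kT : (k < T)%N := leq_trans (ltn_ord k) nT.
apply: measurable_funM; apply/(measurable_wrtP _ sF).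
  by apply: measurable_wrtW (filtration_le (ltnW (ltn_ord k))) _; exact/alive_measurable/ltnW.
by apply: measurable_wrtW (filtration_le (ltn_ord k)) _; exact: increment_measurable.
Qed.

(** * The exponential supermartingale of the stopped sum *)

Hypothesis unbiased : forall n i, (n < T)%N ->
  P.-integrable setT (fun x => (g n.+1 x 0 i)%:E) /\
  forall A, F n A -> (\int[P]_(x in A) (g n.+1 x 0 i)%:E
                      = \int[P]_(x in A) (gradf (W n x) 0 i)%:E)%E.
Hypothesis noisy : forall n, (n < T)%N -> {ae P, forall x, noise n x}.

(** The predictable radius in Hoeffding's bound: it dominates the absolute value of th c Z_n while
    the process is alive and the noise bound holds. *)
Let u th n x := th * c * Num.sqrt V * enorm (gradf (W n x)).

(** After stopping both sides equal 1. Before, [hoeffding_pointwise] applies with radius [u], and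
    u^2 / 2 = th^2 c^2 V Gr / 2 is at most the drift share th * 3/8 eta Gr, because c <= eta and th
    eta V <= 3/4. *)
Lemma increment_le n x (th : R) : 0 < th -> th * eta * V <= 3 / 4 -> noise n x ->
  expR (th * (a n x * q n x)) <=
    1 + \sum_(i < d) xi n x 0 i
          * (- (th * c) * (a n x * (gradf (W n x) 0 i * hoeffding_slope (u th n x)))).
Proof.
move=> th0 thV nx; have /andP[c0 ce] := coef_bounds.
have -> : \sum_(i < d) xi n x 0 i
          * (- (th * c) * (a n x * (gradf (W n x) 0 i * hoeffding_slope (u th n x)))) =
    a n x * (th * c * Z n x * hoeffding_slope (u th n x)).
  rewrite /Z /dotv mulrN mulNr mulrN mulr_sumr mulr_suml mulr_sumr -sumrN.
  by apply: eq_bigr => i _; ring.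
have [[aY aE]|[_ aE]] := alive_bound (Y ^~ x) Fb n; rewrite /a aE; last first.
  by rewrite !mul0r mulr0 expR0 addr0.
have thc : 0 < th * c by rewrite mulr_gt0.
have Zu : `|th * c * Z n x| <= u th n x.
  rewrite normrM gtr0_norm// /u -mulrA ler_pM2l//.
  by apply: noise_dot_bound => //; exact: aY.
rewrite !mul1r; apply: le_trans (hoeffding_pointwise Zu).
rewrite ler_expR /q mulrBr mulrA lerB//.
have V0 := variance_proxy_ge0.
rewrite /u exprMn enorm_sqr -/(Gr n x) exprMn sqr_sqrtr// exprMn.
have h1 : c ^+ 2 <= eta ^+ 2 by rewrite ler_sqr ?nnegrE ?(ltW c0) ?(ltW eta0).
have h2 : 0 <= th ^+ 2 * V * Gr n x by rewrite mulr_ge0 ?sqnorm_grad_ge0// mulr_ge0 ?sqr_ge0.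
have h3 := ler_wpM2l h2 h1.
have h4 : 0 <= th * eta * Gr n x by rewrite mulr_ge0 ?sqnorm_grad_ge0// mulr_ge0// ltW.
have h5 := ler_wpM2l h4 thV.
have E1 : th ^+ 2 * c ^+ 2 * V * Gr n x / 2 = th ^+ 2 * V * Gr n x * c ^+ 2 / 2 by ring.
have E2 : th ^+ 2 * V * Gr n x * eta ^+ 2 = th * eta * Gr n x * (th * eta * V) by ring.
rewrite E1; rewrite E2 in h3.
have E3 : th * (3 / 8 * eta * Gr n x) = 3 / 8 * (th * eta * Gr n x) by ring.
rewrite E3; lra.
Qed.

(** A crude bound, serving only as the almost sure bound on the factor [M] in
    [supermartingale_step]; the drift part of each increment is nonpositive and dropped. *)
Lemma stopped_sum_ae_bounded n : (n <= T)%N -> {ae P, forall x,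
  N n x <= n%:R * (c * (Num.sqrt V * Num.sqrt (2 * beta * Fb)))}.
Proof.
have /andP[c0 ce] := coef_bounds.
elim: n => [_|n IH nT]; first by apply: aeW => x; rewrite /N big_ord0 mul0r.
apply: filterS2 (IH (ltnW nT)) (noisy nT) => x Nx nx.
rewrite /N big_ord_recr/= -/(N n x) -natr1 mulrDl mul1r lerD//.
have B0 : 0 <= c * (Num.sqrt V * Num.sqrt (2 * beta * Fb)).
  by rewrite mulr_ge0 ?(ltW c0)// mulr_ge0 ?sqrtr_ge0.
have [[aY aE]|[_ aE]] := alive_bound (Y ^~ x) Fb n; rewrite /a aE; last by rewrite mul0r.
rewrite mul1r /q; have h : 0 <= 3 / 8 * eta * Gr n x.
  by rewrite mulr_ge0 ?sqnorm_grad_ge0// mulr_ge0 ?divr_ge0// ltW.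
apply: (@le_trans _ _ (c * Z n x)); first by rewrite gerBl.
rewrite ler_pM2l//; apply: le_trans (ler_norm _) _.
have Yn : Y n x <= Fb by exact: aY.
by apply: le_trans (noise_dot_bound nx Yn) _; rewrite ler_wpM2l ?sqrtr_ge0// grad_bound.
Qed.

Lemma expectation_le1 (th : R) n : 0 < th -> th * eta * V <= 3 / 4 -> (n <= T)%N ->
  (\int[P]_x (expR (th * N n x))%:E <= 1)%E.
Proof.
move=> th0 thV; have /andP[c0 ce] := coef_bounds.
elim: n => [_|n IH nT].
  under eq_integral do rewrite /N big_ord0 mulr0 expR0.
  by rewrite integral_cst//= probability_setT mule1.
apply: le_trans (IH (ltnW nT)).
have [sF Fm Fs] := filtF n; have [sF' Fm' _] := filtF n.+1.
pose B i x := - (th * c) * (a n x * (gradf (W n x) 0 i * hoeffding_slope (u th n x))).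
under eq_integral => x _.
  rewrite /N big_ord_recr/= -/(N n x) mulrDr expRD; over.
have cn i := centered_noise sF Fm (unbiased i nT).1 (grad_measurable i (ltnW nT))
               (unbiased i nT).2.
have xiE i x : g n.+1 x 0 i - gradf (W n x) 0 i = xi n x 0 i by rewrite !mxE.
have thc : 0 < th * c by rewrite mulr_gt0.
have mu' : measurable_fun (setT : set (g_sigma_algebraType (F n))) (u th n).
  apply: measurable_funM => //.
  have msq : measurable_fun setT (@Num.sqrt R).
    exact: (continuous_measurable_fun (@sqrt_continuous R)).
  apply: (measurableT_comp msq).
  by apply/(measurable_wrtP _ sF); exact/sqnorm_grad_measurable/ltnW.
(* Here the inverse in [hoeffding_slope], written as a power, inherits the measurability of
   [powR]. *)
have mslope : measurable_fun setT (@hoeffding_slope R).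
  apply: measurable_funM; last exact: measurable_powR.
  apply: measurable_funM => //; apply: measurable_funM.
    apply: measurableT_comp; first exact: measurable_expR.
    by apply: measurableT_comp => //; apply: measurable_funM => //; exact: measurable_funX.
  apply: measurable_funB; first exact: measurable_expR.
  by apply: measurableT_comp => //; exact: measurable_expR.
apply: (@supermartingale_step _ _ _ P (F n) sF Fm d (fun i x => g n.+1 x 0 i - gradf (W n x) 0 i)
   B _ _ (expR (th * (n%:R * (c * (Num.sqrt V * Num.sqrt (2 * beta * Fb))))))
   (th * c * Num.sqrt (2 * beta * Fb))).
- by move=> i; case: (cn i).
- by move=> i; case: (cn i).
- move=> i; apply/(measurable_wrtP _ sF); apply: measurable_funM => //.
  apply: measurable_funM.
    by apply/(measurable_wrtP _ sF); exact/alive_measurable/ltnW.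
  apply: measurable_funM.
    by apply/(measurable_wrtP _ sF); exact/grad_measurable/ltnW.
  exact: measurableT_comp.
- move=> i; apply: aeW => x; rewrite /B normrM normrN (gtr0_norm thc) ler_pM2l//.
  have [[aY aE]|[_ aE]] := alive_bound (Y ^~ x) Fb n; rewrite /a aE; last first.
    by rewrite mul0r normr0 sqrtr_ge0.
  rewrite mul1r normrM.
  have u0 : 0 <= u th n x by rewrite /u mulr_ge0 ?sqrtr_ge0// mulr_ge0 ?sqrtr_ge0// ltW.
  have /andP[k0 k1] := hoeffding_slope_bound u0.
  rewrite (ger0_norm k0); apply: le_trans (ler_piMr _ k1) _ => //.
  by apply: le_trans (coord_le_enorm _ _) _; apply: grad_bound; exact: aY.
- apply/(measurable_wrtP _ sF); apply: measurableT_comp; first exact: measurable_expR.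
  apply: measurable_funM => //.
  by apply/(measurable_wrtP _ sF); exact/stopped_sum_measurable/ltnW.
- by move=> x; exact: expR_ge0.
- by apply: filterS (stopped_sum_ae_bounded (ltnW nT)) => x Nx; rewrite ler_expR ler_pM2l.
- apply: measurableT_comp; first exact: measurable_expR.
  apply: measurable_funM => //; apply: measurable_funM.
    by apply: measurable_wrt_measurable Fm _; exact/alive_measurable/ltnW.
  by apply: measurable_wrt_measurable Fm' _; exact: increment_measurable.
- by move=> x; exact: expR_ge0.
- apply: filterS (noisy nT) => x nx.
  have := increment_le th0 thV nx; under eq_bigr do rewrite -xiE.
  exact.
Qed.

Lemma sgd_high_probability (delta : R) : 0 < delta -> delta <= 1 ->
  exists E : set Om, [/\ measurable E, ((1 - delta)%:E <= P E)%E &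
    forall x, E x -> (forall n, (n < T)%N -> noise n x) /\
       N T x <= 4 / 3 * eta * V * ln delta^-1].
Proof.
move=> dl0 dl1; have /andP[c0 ce] := coef_bounds.
have [M [mM PM0 hM]] : {ae P, forall x, forall n : 'I_T, noise n x}.
  by apply: filter_forall => n; apply: noisy.
have noiseM x : (~` M) x -> forall n, (n < T)%N -> noise n x.
  move=> Mx n nT; apply: contrapT => h; apply: Mx; apply: hM => /= hx.
  exact: h (hx (Ordinal nT)).
have V0 := variance_proxy_ge0.
(* Removing the null set [M], where one of the finitely many noise bounds may fail, costs no
   probability. *)
have PMC A : measurable A -> (P A <= P (~` M `&` A))%E.
  move=> mA; rewrite -[leRHS]adde0 -[X in (_ + X)%E]PM0.
  apply: le_trans (measureU2 _ _ _) => //; last by apply: measurableI => //; exact: measurableC.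
  apply: le_measure; rewrite ?inE//.
    by apply: measurableU => //; apply: measurableI => //; exact: measurableC.
  by move=> x Ax; have [Mx|Mx] := pselect (M x); [right | left].
(* If [V = 0], the exponent [3 / (4 eta V)] is meaningless, but then [Z] vanishes. *)
have [V00|Vn0] := eqVneq V 0.
  exists (~` M); split; first exact: measurableC.
    have := PMC setT measurableT; rewrite setIT probability_setT; apply: le_trans.
    by rewrite lee_fin gerBl ltW.
  move=> x Mx; split; first exact: noiseM.
  rewrite V00 mulr0 mul0r; apply: sumr_le0 => k _.
  have [[aY aE]|[_ aE]] := alive_bound (Y ^~ x) Fb k; rewrite /a aE; last by rewrite mul0r.
  have Yk : Y k x <= Fb by exact: aY.
  have := noise_dot_bound (noiseM x Mx k (ltn_ord k)) Yk.
  rewrite V00 sqrtr0 mul0r normr_le0 /q => /eqP ->.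
  by rewrite mulr0 sub0r mul1r oppr_le0 mulr_ge0 ?sqnorm_grad_ge0// mulr_ge0 ?divr_ge0// ltW.
have Vp : 0 < V by rewrite lt_def Vn0.
(* The largest exponent allowed by [increment_le]; dividing ln(1/delta) by it gives the announced
   bound. *)
pose th := 3 / 4 / (eta * V).
have eV : 0 < eta * V by rewrite mulr_gt0.
have th0 : 0 < th by rewrite divr_gt0// divr_gt0.
have thV : th * eta * V = 3 / 4 by rewrite -mulrA divfK// gt_eqF.
have [_ FmT _] := filtF T.
have mN := measurable_wrt_measurable FmT (stopped_sum_measurable (leqnn T)).
have mQ : measurable_fun setT (fun x => th * N T x) by exact: measurable_funM.
have thV' : th * eta * V <= 3 / 4 by rewrite thV.
have h := markov_expR dl0 mQ (expectation_le1 th0 thV' (leqnn T)).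
set A := [set x | _] in h.
have mA : measurable A.
  rewrite /A -[X in measurable X]setTI.
  rewrite (_ : [set x | _] = (fun x => th * N T x) @^-1` `]-oo, ln delta^-1]); first exact: mQ.
  by apply/seteqP; split=> x; rewrite /= in_itv.
exists (~` M `&` A); split; first by apply: measurableI => //; exact: measurableC.
  exact: le_trans h (PMC _ mA).
move=> x [Mx Ax]; split; first exact: noiseM.
move: Ax; rewrite /A/= mulrC -ler_pdivlMr//.
suff -> : 4 / 3 * eta * V * ln delta^-1 = ln delta^-1 / th by [].
by rewrite /th; field; rewrite !gt_eqF.
Qed.
End SGD.

Unset Implicit Arguments.

Theorem theorem5
  (R : realType) (d : nat) (f : 'rV[R]_d -> R) (gradf : 'rV[R]_d -> 'rV[R]_d)
  (beta fstar alpha delta s0 s1 : R) (T : nat)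
  (d0 : measure_display) (Om : measurableType d0) (P : probability Om R)
  (F : nat -> set (set Om)) (g : nat -> Om -> 'rV[R]_d) (w1 : 'rV[R]_d) :
  is_gradient f gradf ->
  0 < beta -> smooth beta gradf ->
  (forall w, fstar <= f w) -> (exists w, f w = fstar) ->
  0 < alpha -> 0 < delta -> delta < 2^-1 ->
  0 <= s0 -> 0 <= s1 ->
  (0 < T)%N ->
  let eta := step_size beta alpha delta s0 s1 T in
  let w := sgd w1 eta g in
  filtration F ->
  (* g_t is F_t-measurable (the filtration contains the oracle's history) *)
  (forall t i, (1 <= t <= T)%N -> measurable_wrt (F t) (fun x => g t x 0 i)) ->
  (* unbiasedness: E[g_t | F_{t-1}] = grad f (w_t) *)
  (forall t i, (1 <= t <= T)%N ->
     P.-integrable setT (fun x => (g t x 0 i)%:E) /\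
     forall A, F t.-1 A ->
       (\int[P]_(x in A) (g t x 0 i)%:E = \int[P]_(x in A) (gradf (w t x) 0 i)%:E)%E) ->
  (* bounded affine noise, almost surely *)
  (forall t, (1 <= t <= T)%N ->
     {ae P, forall x, sqnorm (g t x - gradf (w t x))
                        <= s0 ^+ 2 + s1 ^+ 2 * sqnorm (gradf (w t x))}) ->
  let Delta1 := f w1 - fstar in
  let LT := log2 (T%:R / delta) in
  let L1 := log2 (delta^-1) in
  let Fb := 2 * Delta1 + 2 * beta * alpha ^+ 2
            + 3 * Num.min (s0 ^+ 2 / (4 * beta * (1 + s1 ^+ 2 * LT)))
                          (s0 * alpha / Num.sqrt T%:R) * LT in
  exists E : set Om, [/\ measurable E, ((1 - 2 * delta)%:E <= P E)%E &
    forall x, E x ->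
      (T%:R^-1 * \sum_(1 <= t < T.+1) sqnorm (gradf (w t x))
        <= (beta * alpha + Delta1 / alpha) * (2 * s0 / Num.sqrt T%:R)
           + (8 * beta * Delta1 * (1 + 4 * s1 ^+ 2) * LT
              + 24 * s1 ^+ 2 * beta ^+ 2 * alpha ^+ 2 * L1
              + 15 * s0 ^+ 2 * L1) * T%:R^-1)
      /\ (forall t, (1 <= t <= T.+1)%N -> f (w t x) - fstar <= Fb)].
Proof.
move=> fg b0 sm fs _ a0 dl0 dl2 s00 s10 T0 eta w filtF mg unb noi Delta1 LT L1 Fb.
have eta0 : 0 < eta by exact: step_size_gt0.
have D10 : 0 <= Delta1 by rewrite subr_ge0.
have Fb0 : 0 < Fb by exact: level_gt0.
(* The step size provides this with [s1 ^+ 2 * LT] in place of [s1 ^+ 2], which is stronger because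
   [LT >= 1]. *)
have etale : 4 * beta * eta * (1 + s1 ^+ 2) <= 1.
  have := @step_size_le R beta alpha delta s0 s1 T b0 dl0 dl2 T0.
  apply: le_trans; rewrite -/eta -/LT.
  have -> : eta * (4 * beta * (1 + s1 ^+ 2 * LT)) = 4 * beta * eta * (1 + s1 ^+ 2 * LT).
    by ring.
  rewrite ler_pM2l ?mulr_gt0// lerD2l ler_peMr ?sqr_ge0//.
  exact: log_horizon_ge1.
have mg' n i : (n < T)%N -> measurable_wrt (F n.+1) (fun x => g n.+1 x 0 i).
  by move=> nT; apply: mg.
have unb' n i : (n < T)%N -> P.-integrable setT (fun x => (g n.+1 x 0 i)%:E) /\
  forall A, F n A -> (\int[P]_(x in A) (g n.+1 x 0 i)%:E
     = \int[P]_(x in A) (gradf (sgd_aux w1 eta g n x) 0 i)%:E)%E.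
  by move=> nT; apply: (unb n.+1 i).
have noi' n : (n < T)%N -> {ae P, forall x,
    sqnorm (g n.+1 x - gradf (sgd_aux w1 eta g n x))
      <= s0 ^+ 2 + s1 ^+ 2 * sqnorm (gradf (sgd_aux w1 eta g n x))}.
  by move=> nT; apply: (noi n.+1).
have dl1 : delta <= 1 by lra.
have [E [mE PE hE]] := sgd_high_probability fg b0 sm fs eta0 etale Fb0 filtF mg' unb'
  noi' dl0 dl1.
exists E; split=> //.
  (* A single event of probability at least 1 - delta serves both conclusions. *)
  by apply: le_trans PE; rewrite lee_fin; lra.
move=> x /hE[nx Nx].
have e0 : 0 <= beta * eta ^+ 2 * s0 ^+ 2 / 2.
  by rewrite divr_ge0// mulr_ge0 ?sqr_ge0// mulr_ge0 ?sqr_ge0// ltW.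
have eta2 : 0 <= eta / 2 by rewrite divr_ge0// ltW.
have step n (nT : (n < T)%N) := sgd_descent fstar fg b0 sm eta0 etale (nx n nT).
have budget := @budget_le R beta alpha delta s0 s1 T b0 a0 dl0 dl2 s00 s10 T0 Delta1 D10.
have [YF SG] := stopped_descent eta2 e0
  (fun n => gap_ge0 eta g w1 fs n x) (fun n => sqnorm_grad_ge0 gradf eta g w1 n x) step Nx budget.
split; last first.
  (* [w t.+1] is the [t]-th shifted iterate, so the range 1, ..., T+1 becomes 0, ..., T. *)
  by case=> [//|t] /andP[_ tT]; exact: YF.
have := @average_le R beta alpha delta s0 s1 T b0 a0 dl0 dl2 s00 s10 T0 Delta1 D10 _ SG.
apply: le_trans; rewrite ler_wpM2l ?invr_ge0//.
by rewrite big_add1/= big_mkord.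
Qed.
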